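(* Let $G_0=(G,* )$ be a noncommutative groupoid and let $G'$ be a groupoid. Then $G_0\stackrel{H}{\cong}G'$ if and only if $G'$ is isomorphic to a principal h-groupoid of $G_0$.
   Context: A groupoid is a nonempty set with a binary operation. For groupoids $(A,* )$ and $(B,\cdot)$, a bijection $f:A\to B$ is a half-isomorphism if $f(x*y)\in\{f(x)\cdot f(y),f(y)\cdot f(x)\}$ for all $x,y\in A$; it is special if $f^{-1}:B\to A$ is also a half-isomorphism. $A\stackrel{H}{\cong}B$ means that there exists a special half-isomorphism between $A$ and $B$. A principal h-groupoid of $G_0=(G,* )$ is a groupoid $(G,\cdot)$ on the same underlying set $G$ for which the identity mapping $I_d:G_0\to(G,\cdot)$ is a special half-isomorphism. *)

(* Defs.v *)
From mathcomp Require Import all_boot.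

Set Implicit Arguments.
Unset Strict Implicit.
Unset Printing Implicit Defensive.

(* "Groupoid" in the sense of a magma on a nonempty set.  MathComp's magmaType
   is not used because it would impose a choiceType structure on the carrier. *)
Record groupoid_on (T : Type) := GroupoidOn {
  gop : T -> T -> T;
  gop_nonempty : inhabited T
}.

Record groupoid := Groupoid {
  gcarrier :> Type;
  gstruct : groupoid_on gcarrier
}.

Definition gmul (A : groupoid) : A -> A -> A := gop (gstruct A).

Definition noncommutative (A : groupoid) : Prop := ~ commutative (@gmul A).

Definition half_isomorphism (A B : groupoid) (f : A -> B) : Prop :=
  bijective f /\
  forall x y : A,
    f (gmul x y) = gmul (f x) (f y) \/ f (gmul x y) = gmul (f y) (f x).

(* The two cancellation conditions say that g is the inverse of f. *)
Definition special_half_isomorphism (A B : groupoid) (f : A -> B) : Prop :=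
  half_isomorphism f /\
  exists g : B -> A, [/\ cancel f g, cancel g f & half_isomorphism g].

Definition half_isomorphic (A B : groupoid) : Prop :=
  exists f : A -> B, special_half_isomorphism f.

Definition isomorphic (A B : groupoid) : Prop :=
  exists f : A -> B,
    bijective f /\ {morph f : x y / gmul x y >-> gmul x y}.

Definition principal_h_groupoid (A : groupoid) (s : groupoid_on A) : Prop :=
  @special_half_isomorphism A (Groupoid s) (fun x : A => x).

(* Main.v *)
Require Import Defs.
From mathcomp Require Import all_boot.

(** Pulling the product of [G'] back along a special half-isomorphism turns that map into an
    isomorphism and leaves the possible swap of factors to the identity of [G0]. Conversely, the
    identity followed by an isomorphism is again a special half-isomorphism. *)

Theorem proposition4p1 (G0 G' : groupoid) (hG0 : noncommutative G0) :
  half_isomorphic G0 G' <->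
  exists s : groupoid_on G0,
    principal_h_groupoid s /\ isomorphic G' (Groupoid s).
Proof.
split.
- case=> f [[_ fM] [g [fK gK [g_bij gM]]]].
  (* Transport the product of G' to the carrier of G0 along f. *)
  pose s := GroupoidOn (fun x y => g (gmul (f x) (f y)))
                       (gop_nonempty (gstruct G0)).
  have id_bij : bijective (fun x : G0 => x) by exists id.
  exists s; split; last first.
    by exists g; split=> // x y; rewrite /gmul /= !gK.
  split.
    split=> // x y.
    by case: (fM x y) => /(congr1 g); rewrite fK; [left | right].
  exists (fun x => x); split=> //; split=> // x y.
  by have := gM (f x) (f y); rewrite !fK.
- case=> s [[[_ idM] [i [iK _ [_ iM]]]] [h [[k hK kK] hM]]].
  have h_bij : bijective h by exists k.
  have k_bij : bijective k by exists h.
  have kM (x y : G0) : k (@gmul (Groupoid s) x y) = gmul (k x) (k y).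
    by apply: (can_inj hK); rewrite hM !kK.
  exists k; split.
    split=> // x y.
    by case: (idM x y) => /= ->; rewrite kM; [left | right].
  exists h; split=> //; split=> // a b.
  (* By [iK] the inverse [i] fixes every point, so [iM] says that a product in [s] is a product in
     [G0] in one of the two orders. *)
  by rewrite hM; have := iM (h a) (h b); rewrite !iK.
Qed.
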